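(* Let $T>0$, $\xi_M>0$, $\kappa>0$, $\rho>0$, $e_F>0$, let $L>0$ be a target for the accumulated emissions and let $\varepsilon\in(0,1)$ be a threshold. Let the demand $D\ge 0$ and the capacity factor $V\in(0,1]$ be time-independent random variables on a probability space $(\Omega,\mathcal F,\mathbb P)$ such that $$\mathbb P\left(e_F T D> L\right)>\varepsilon,\qquad \mathbb P\left(D<\xi_M V\right)=0 .$$ Let $z_\varepsilon$ be the $\varepsilon$-upper quantile of the random variable $\dfrac{TD-L/e_F}{V}$, and assume $$0<\frac{z_\varepsilon}{T}\le \xi_M .$$ Consider the one-intervention installation problem $$\min_{0\le t\le T,\ \xi\in(0,\xi_M]}\ \kappa\,\xi\, e^{-\rho t}\qquad\text{subject to}\qquad \mathbb P\left(E(t,\xi,T)>L\right)=\varepsilon,$$ where $$E(t,\xi,T)=e_F\int_t^T (D-\xi V)^+\,ds+e_F\int_0^t D\,ds .$$ Then: 1. If $\frac1T\le\rho\le\frac{\xi_M}{z_\varepsilon}$, the optimal solution is uniquely determined by $\hat t=T-\frac1\rho$ and $\hat\xi_\varepsilon=\rho z_\varepsilon$. 2. If $\rho<\frac1T$, the optimal solution is given by $\hat t=0$ and $\hat\xi_\varepsilon=\frac{z_\varepsilon}{T}$. 3. If $\rho>\frac{\xi_M}{z_\varepsilon}$, the optimal solution is given by $\hat t=T-\frac{z_\varepsilon}{\xi_M}$ and $\hat\xi_\varepsilon=\xi_M$.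
   Context: Setting: a single renewable technology with initial installed capacity $C_R(0^-)=0$. One capacity expansion of size $\xi$ is made at a deterministic time $t$, so the installed capacity is $C_R(s)=\xi\mathbf 1[s\ge t]$ and renewable production is $P_R(s)=C_R(s)V$. There are no fixed costs; the proportional cost per unit capacity at time $t$ is $\kappa e^{-\rho t}$, with $\rho$ the discount rate. The maximal fossil production is a constant $C_F>0$, and it is a standing assumption that $D-P_R(s)\le C_F$ for all $s\in[0,T]$ (no imports), so that with emission rate $e_F$ the accumulated emissions up to $T$ are $E(t,\xi,T)$ as in the claim. Here $x^+=\max(x,0)$. The $\varepsilon$-upper quantile $z_\varepsilon$ of a random variable $X$ is the (unique) real number with $\mathbb P(X>z_\varepsilon)=\varepsilon$; its existence and uniqueness for $X=(TD-L/e_F)/V$ is part of the assumption that $z_\varepsilon$ is given, so that the constraint $\mathbb P(X>\xi(T-t))=\varepsilon$ is equivalent to $\xi(T-t)=z_\varepsilon$. *)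

(* Defs.v *)
From HB Require Import structures.
From mathcomp Require Import all_boot all_order all_algebra.
From mathcomp Require Import all_classical all_reals all_analysis.

Set Implicit Arguments.
Unset Strict Implicit.
Unset Printing Implicit Defensive.

Import Order.TTheory GRing.Theory Num.Theory.
Import numFieldNormedType.Exports.

Local Open Scope classical_set_scope.
Local Open Scope ring_scope.

Section InstallationProblem.
Context {d : measure_display} {Omega : measurableType d} {R : realType}.
Context (P : probability Omega R).

(* The quantile is the unique solution of P(X > z) = eps; uniqueness is not
   automatic, since X may have no mass on an interval. *)
Definition upper_quantile (X : Omega -> R) (eps z : R) : Prop :=
  unique (fun x : R => P [set w | x < X w] = eps%:E) z.

Definition installed_capacity (t xi s : R) : R := if t <= s then xi else 0.

Definition renewable_production (V : Omega -> R) (t xi s : R) (w : Omega) : R :=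
  installed_capacity t xi s * V w.

Definition emissions (eF : R) (D V : Omega -> R) (t xi T : R) (w : Omega) : R :=
  eF * (\int[lebesgue_measure]_(s in `[t, T]) (Num.max (D w - xi * V w) 0))
  + eF * (\int[lebesgue_measure]_(s in `[0%R, t]) (D w)).

(* Decisions are pairs (t, xi). *)
Definition admissible (T xiM : R) (p : R * R) : Prop :=
  0 <= p.1 <= T /\ 0 < p.2 <= xiM.

Definition installation_cost (kappa rho : R) (p : R * R) : R :=
  kappa * p.2 * expR (- (rho * p.1)).

Definition feasible (T xiM eF L eps : R) (D V : Omega -> R) (p : R * R) : Prop :=
  admissible T xiM p /\
  P [set w | L < emissions eF D V p.1 p.2 T w] = eps%:E.

Definition optimal (T xiM kappa rho eF L eps : R) (D V : Omega -> R)
    (p : R * R) : Prop :=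
  feasible T xiM eF L eps D V p /\
  forall q, feasible T xiM eF L eps D V q ->
    installation_cost kappa rho p <= installation_cost kappa rho q.

End InstallationProblem.

(* Main.v *)
Require Import Defs.
From HB Require Import structures.
From mathcomp Require Import all_boot all_order all_algebra.
From mathcomp Require Import all_classical all_reals all_analysis.
From mathcomp Require Import measurable_realfun ring lra.

Set Implicit Arguments.
Unset Strict Implicit.
Unset Printing Implicit Defensive.

Import Order.TTheory GRing.Theory Num.Theory.
Import numFieldNormedType.Exports.

Local Open Scope classical_set_scope.
Local Open Scope ring_scope.

(** Since [D] dominates [xiM * V] almost surely, no admissible capacity ever
    saturates the demand, and the accumulated emissions are almost surely
    [eF * (T * D - xi * (T - t) * V)]. As [V > 0], they exceed [L] exactly when
    [(T * D - L / eF) / V] exceeds [xi * (T - t)]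
    ([emissions_exceed_probE]). Uniqueness of the quantile turns the chance
    constraint into the deterministic curve [xi * (T - t) = z].

    Along this curve, in terms of the remaining time [u := T - t], the bound
    [xi <= xiM] reads [z / xiM <= u <= T] and the cost is a positive multiple of
    [expR (rho * u) / u] ([installation_costE]). That function strictly decreases
    up to [u = rho^-1] and strictly increases afterwards, so its only minimizer
    is [rho^-1] clamped to [[z / xiM, T]]; the three regimes are the three cases
    of the clamping. The minimization uses no calculus: the strict inequality
    [1 + x < expR x] for [x != 0] gives both minimality and uniqueness
    ([expR_ratio_lt], [unique_optimal]). *)

(** The two integrands do not depend on the time variable, so the emissions are
    elementary. *)
Lemma emissionsE d (Omega : measurableType d) (R : realType) (eF : R)
    (D V : Omega -> R) (t xi T : R) (w : Omega) : 0 <= t <= T ->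
  emissions eF D V t xi T w =
  eF * ((T - t) * Num.max (D w - xi * V w) 0 + t * D w).
Proof.
have fine_itv (a b : R) : a <= b ->
    fine (lebesgue_measure (`[a, b]%classic : set R)) = b - a.
  move=> ab; rewrite lebesgue_measure_itv /= lte_fin.
  by case: ltgtP ab => //= -> _; rewrite subrr.
move=> /andP[t0 tT]; rewrite /emissions !Rintegral_cst//; try exact: measurable_itv.
by rewrite !fine_itv//; ring.
Qed.

(** Inversion is discontinuous at zero, so continuity does not apply; it equals
    [x * (x ^ 2) `^ (-1)] everywhere, zero included, and real powers are
    measurable. *)
Lemma measurable_inv (R : realType) : measurable_fun [set: R] (@GRing.inv R).
Proof.
rewrite (_ : GRing.inv = (fun x : R => x * (x ^+ 2) `^ (-1))).
  apply: measurable_funM; first exact: measurable_id.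
  by apply: (measurableT_comp (measurable_powR _)); exact: exprn_measurable.
apply/funext => x; rewrite powR_inv1 ?sqr_ge0//.
have [->|x0] := eqVneq x 0; first by rewrite invr0 mul0r.
by field.
Qed.

Lemma measurable_lt_set d (T : measurableType d) (R : realType) (f g : T -> R) :
  measurable_fun setT f -> measurable_fun setT g ->
  measurable [set x | f x < g x].
Proof.
move=> mf mg; have := measurable_fun_ltr mf mg.
by move=> /(_ measurableT [set true]); rewrite setTI; exact.
Qed.

Lemma measure_ae_eq d (T : measurableType d) (R : realType)
    (mu : {measure set T -> \bar R}) (A B : set T) :
  measurable A -> measurable B -> {ae mu, forall x, A x <-> B x} ->
  mu A = mu B.
Proof.
have null (A' B' : set T) : measurable A' -> measurable B' ->
    {ae mu, forall x, A' x <-> B' x} -> mu (A' `\` B') = 0%E.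
  move=> mA mB AB; apply: measure_negligible; first exact: measurableD.
  by apply: negligibleS AB => x /= [Ax nBx] /iffLR /(_ Ax).
move=> mA mB AB; rewrite (measureDI mu mA mB) (measureDI mu mB mA) setIC.
congr (_ + _)%E.
transitivity (0 : \bar R)%E.
  exact: null.
by apply/esym/null => //; apply: filterS AB => x; exact: iff_sym.
Qed.

(** Almost surely the production [xi * V] never exceeds the demand, so the positive
    part is inactive and the target is missed exactly when the quantile variable
    exceeds [xi * (T - t)]. *)
Lemma emissions_exceed_probE d (Omega : measurableType d) (R : realType)
    (P : probability Omega R) (D V : {RV P >-> R}) (T xiM eF L t xi : R) :
  0 < eF -> {ae P, forall w, 0 < V w <= 1} ->
  P [set w | D w < xiM * V w] = 0%E ->
  admissible T xiM (t, xi) ->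
  P [set w | L < emissions eF D V t xi T w] =
  P [set w | xi * (T - t) < (T * D w - L / eF) / V w].
Proof.
move=> eF0 hV hdemand [/= t0T /andP[xi0 xiM_]].
have mD : measurable_fun setT D by [].
have mV : measurable_fun setT V by [].
have mc (c : R) : measurable_fun [set: Omega] (fun=> c) by exact: measurable_cst.
(* Almost sure agreement determines the probability of measurable events only. *)
apply: measure_ae_eq.
- under eq_set do rewrite emissionsE//.
  apply: measurable_lt_set => //.
  apply: measurable_funM => //; apply: measurable_funD; last exact: measurable_funM.
  apply: measurable_funM => //; apply: measurable_maxr => //.
  by apply: measurable_funB => //; exact: measurable_funM.
- apply: measurable_lt_set => //; apply: measurable_funM.
    by apply: measurable_funB => //; exact: measurable_funM.
  by apply: measurableT_comp mV; exact: measurable_inv.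
have dem : {ae P, forall w, xiM * V w <= D w}.
  apply: (@negligibleS _ _ _ _ [set w | D w < xiM * V w]).
    by move=> w /= /negP; rewrite -ltNge.
  apply/negligibleP => //.
  by apply: measurable_lt_set => //; exact: measurable_funM.
apply: filterS2 hV dem => w /andP[V0 _] DV; rewrite /= emissionsE//.
have DxiV : 0 <= D w - xi * V w.
  by rewrite subr_ge0 (le_trans _ DV)// ler_wpM2r// ltW.
rewrite max_l// ltr_pdivlMr//.
have eFL : eF * (L / eF) = L by rewrite mulrCA divff ?gt_eqF// mulr1.
rewrite -[X in X < eF * _]eFL ltr_pM2l//.
by split => ?; lra.
Qed.

(** Strict form of a tangent line bound for [u |-> exp (rho * u) / u]: the
    exponential lies strictly above its tangent at [u0], and the last hypothesis
    says that this tangent is at least [u / u0] times its value at [u0]. *)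
Lemma expR_ratio_lt (R : realType) (rho u0 u : R) :
  0 < rho -> 0 < u0 -> 0 < u -> u != u0 ->
  u - u0 <= rho * u0 * (u - u0) ->
  expR (rho * u0) / u0 < expR (rho * u) / u.
Proof.
move=> rho0 u00 u_gt0 uu0 tangent.
rewrite ltr_pdivrMr// mulrAC ltr_pdivlMr//.
have -> : rho * u = rho * u0 + rho * (u - u0) by ring.
rewrite expRD -mulrA ltr_pM2l ?expR_gt0//.
have /expR_gt1Dx : rho * (u - u0) != 0.
  by apply: mulf_neq0; [exact: lt0r_neq0|rewrite subr_eq0].
rewrite -(ltr_pM2r u00); apply: le_lt_trans.
by lra.
Qed.

(** On the curve [xi * (T - t) = z] the cost depends on the remaining time only. *)
Lemma installation_costE (R : realType) (kappa rho z T t xi : R) :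
  0 < T - t -> xi * (T - t) = z ->
  installation_cost kappa rho (t, xi) =
  kappa * z * expR (- (rho * T)) * (expR (rho * (T - t)) / (T - t)).
Proof.
move=> u0 <-; rewrite /installation_cost /=.
have -> : - (rho * t) = - (rho * T) + rho * (T - t) by ring.
by rewrite expRD; field; rewrite gt_eqF.
Qed.

(** The last hypothesis says that [u - u0] and [rho * u0 - 1] never have opposite
    signs. This covers the three regimes at once: [u0] is the stationary point
    [rho^-1], or it is the endpoint [T] before that point, or the endpoint
    [z / xiM] beyond it. *)
Lemma unique_optimal d (Omega : measurableType d) (R : realType)
    (P : probability Omega R) (D V : Omega -> R)
    (T xiM kappa rho eF L eps z u0 : R) :
  0 < xiM -> 0 < kappa -> 0 < rho -> 0 < z ->
  (forall t xi, feasible P T xiM eF L eps D V (t, xi) <->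
     admissible T xiM (t, xi) /\ xi * (T - t) = z) ->
  z / xiM <= u0 <= T ->
  (forall u, z / xiM <= u <= T -> u - u0 <= rho * u0 * (u - u0)) ->
  unique (optimal P T xiM kappa rho eF L eps D V) (T - u0, z / u0).
Proof.
move=> xiM0 kappa0 rho0 z0 feasP /andP[u0l u0T] tangent.
have zxiM : 0 < z / xiM by exact: divr_gt0.
have u00 : 0 < u0 by exact: lt_le_trans u0l.
have TB : T - (T - u0) = u0 by ring.
have xiu0 : z / u0 * (T - (T - u0)) = z by rewrite TB divfK ?gt_eqF.
have feas0 : feasible P T xiM eF L eps D V (T - u0, z / u0).
  apply/feasP; split=> //; split => /=; first by lra.
  by rewrite divr_gt0//= ler_pdivrMr// mulrC -ler_pdivrMr.
have better q : feasible P T xiM eF L eps D V q -> q <> (T - u0, z / u0) ->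
    installation_cost kappa rho (T - u0, z / u0) < installation_cost kappa rho q.
  case: q => t xi /feasP[[/= /andP[t0 tT] /andP[xi0 xile]] xit] neq.
  have Tt : 0 < T - t by rewrite -(pmulr_rgt0 _ xi0) xit.
  rewrite (installation_costE _ _ _ xiu0) ?TB// (installation_costE _ _ Tt xit).
  rewrite ltr_pM2l ?mulr_gt0 ?expR_gt0//; apply: expR_ratio_lt => //.
    apply/eqP => Ttu0; apply: neq; congr (_, _); first by rewrite -Ttu0; ring.
    by rewrite -xit Ttu0 mulfK ?gt_eqF.
  apply: tangent; apply/andP; split; last by lra.
  by rewrite ler_pdivrMr// -xit mulrC ler_pM2l.
split; first split => //.
- move=> q fq; have [->//|/eqP qneq] := eqVneq q (T - u0, z / u0).
  exact/ltW/better.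
- move=> q [fq qmin]; apply: contrapT => /nesym /(better _ fq).
  by rewrite ltNge qmin.
Qed.

Theorem theorem3p2 (R : realType) (d : measure_display)
  (Omega : measurableType d) (P : probability Omega R)
  (D V : {RV P >-> R})
  (T xiM kappa rho eF CF L eps z : R)
  (hT : 0 < T) (hxiM : 0 < xiM) (hkappa : 0 < kappa) (hrho : 0 < rho)
  (heF : 0 < eF) (hCF : 0 < CF) (hL : 0 < L) (heps : 0 < eps < 1)
  (hD : {ae P, forall w, 0 <= D w})
  (hV : {ae P, forall w, 0 < V w <= 1})
  (hnoimport : forall t xi s : R,
     admissible T xiM (t, xi) -> 0 <= s <= T ->
     {ae P, forall w, D w - renewable_production V t xi s w <= CF})
  (htarget : (eps%:E < P [set w | L < eF * T * D w]%R)%E)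
  (hdemand : P [set w | D w < xiM * V w] = 0%E)
  (hz : upper_quantile P (fun w => (T * D w - L / eF) / V w) eps z)
  (hzT : 0 < z / T <= xiM) :
  [/\ T^-1 <= rho <= xiM / z ->
        unique (optimal P T xiM kappa rho eF L eps D V)
          (T - rho^-1, rho * z),
      rho < T^-1 ->
        unique (optimal P T xiM kappa rho eF L eps D V) (0, z / T)
    & xiM / z < rho ->
        unique (optimal P T xiM kappa rho eF L eps D V) (T - z / xiM, xiM)].
Proof.
have z0 : 0 < z by case/andP: hzT => h _; rewrite -(pmulr_lgt0 z (x := T^-1)) ?invr_gt0.
have feasP t xi : feasible P T xiM eF L eps D V (t, xi) <->
    admissible T xiM (t, xi) /\ xi * (T - t) = z.
  split=> -[adm].
    rewrite (emissions_exceed_probE L heF hV hdemand adm) => Peps.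
    by split=> //; apply/esym; exact: hz.2.
  move=> xiz; split => //.
  by rewrite (emissions_exceed_probE L heF hV hdemand adm) xiz; exact: hz.1.
have opt := unique_optimal hxiM hkappa hrho z0 feasP.
have zxiM : 0 < z / xiM by exact: divr_gt0.
have zxiMT : z / xiM <= T.
  by case/andP: hzT => _; rewrite !ler_pdivrMr// mulrC.
split.
- case/andP => lo hi.
  have -> : rho * z = z / rho^-1 by rewrite invrK mulrC.
  apply: opt => [|u _]; last by rewrite mulfV ?gt_eqF// mul1r.
  rewrite invf_ple ?posrE// lo andbT.
  by rewrite -[z / xiM]invrK lef_pV2 ?posrE ?invr_gt0// invf_div.
- rewrite -[X in _ < X]mul1r ltr_pdivlMr// => rhoT.
  rewrite -(subrr T); apply: opt => [|u /andP[_ uT]].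
    by rewrite zxiMT lexx.
  have : 0 <= (1 - rho * T) * (T - u) by rewrite mulr_ge0// subr_ge0// ltW.
  lra.
- rewrite ltr_pdivrMr// => rhoz.
  have xiME : z / (z / xiM) = xiM by field; rewrite !gt_eqF.
  rewrite -{3}xiME; apply: opt => [|u /andP[ul _]].
    by rewrite lexx.
  by rewrite ler_peMl ?subr_ge0// mulrA ler_pdivlMr// mul1r ltW.
Qed.
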